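(* Let $\xi\in\mathbb{R}$ be such that $1,\xi,\xi^3$ are linearly independent over $\mathbb{Q}$, let $\lambda,c>0$ be such that for each sufficiently large real number $X$ there exists a non-zero point $\mathbf{x}\in\mathbb{Z}^3$ with $\|\mathbf{x}\|\le X$ and $L(\mathbf{x})\le cX^{-\lambda}$, and let $(\mathbf{x}_i)_{i\ge1}$ be a sequence of minimal points for $(1,\xi,\xi^3)$. Suppose that $\lambda>2/3$. Then $\varphi(\mathbf{x}_i)\ne 0$ for each sufficiently large index $i$.
   Context: For $\mathbf{x}=(x_0,x_1,x_2)\in\mathbb{R}^3$, put $\|\mathbf{x}\|=\max\{|x_0|,|x_1|,|x_2|\}$ and $L(\mathbf{x})=\max\{|x_1-x_0\xi|,|x_2-x_0\xi^3|\}$. A sequence of minimal points for $(1,\xi,\xi^3)$ is a sequence $(\mathbf{x}_i)_{i\ge1}$ of non-zero points of $\mathbb{Z}^3$ such that, with $X_i=\|\mathbf{x}_i\|$ and $L_i=L(\mathbf{x}_i)$: (a) $X_1<X_2<X_3<\cdots$; (b) $1/2>L_1>L_2>L_3>\cdots$; (c) if $L(\mathbf{x})<L_i$ for some $\mathbf{x}\in\mathbb{Z}^3\setminus\{0\}$ and some $i\ge1$, then $\|\mathbf{x}\|\ge X_{i+1}$. The cubic form $\varphi$ is $\varphi(\mathbf{x})=x_0^2x_2-x_1^3$. *)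

(* Defs.v *)
From HB Require Import structures.
From mathcomp Require Import all_boot all_order all_algebra.
From mathcomp Require Import all_classical all_reals all_analysis.
Set Implicit Arguments.
Unset Strict Implicit.
Unset Printing Implicit Defensive.
Import Order.TTheory GRing.Theory Num.Theory.
Import numFieldNormedType.Exports.
Local Open Scope classical_set_scope.
Local Open Scope ring_scope.

Definition lin_indep_rat (R : realType) (s : seq R) : Prop :=
  forall q : 'I_(size s) -> rat,
    \sum_(i < size s) ratr (q i) * s`_i = 0 -> forall i, q i = 0.

Definition real_point (R : realType) (x : 'rV[int]_3) : 'rV[R]_3 :=
  map_mx intr x.

(* MathComp-Analysis's norm `|x| on row vectors is the maximum norm, so that
   `|real_point R x| is max(|x_0|, |x_1|, |x_2|). *)

Definition L (R : realType) (xi : R) (x : 'rV[R]_3) : R :=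
  Num.max `|x 0 1 - x 0 0 * xi| `|x 0 2 - x 0 0 * xi ^+ 3|.

Definition phi (K : comNzRingType) (x : 'rV[K]_3) : K :=
  x 0 0 ^+ 2 * x 0 2 - x 0 1 ^+ 3.

(* Sequences are indexed by i >= 1; the value of x at 0 is irrelevant. *)
Record minimal_points (R : realType) (xi : R) (x : nat -> 'rV[int]_3) : Prop :=
  MinimalPoints {
    minimal_points_neq0 : forall i, (1 <= i)%N -> x i != 0;
    minimal_points_norm : forall i, (1 <= i)%N ->
      `|real_point R (x i)| < `|real_point R (x i.+1)|;
    minimal_points_L_half : L xi (real_point R (x 1%N)) < 1 / 2;
    minimal_points_L : forall i, (1 <= i)%N ->
      L xi (real_point R (x i.+1)) < L xi (real_point R (x i));
    minimal_points_min : forall (i : nat) (y : 'rV[int]_3), (1 <= i)%N ->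
      y != 0 -> L xi (real_point R y) < L xi (real_point R (x i)) ->
      `|real_point R (x i.+1)| <= `|real_point R y|
  }.

(* Main.v *)
Require Import Defs.
From HB Require Import structures.
From mathcomp Require Import all_boot all_order all_algebra.
From mathcomp Require Import all_classical all_reals all_analysis.
From mathcomp Require Import ring lra zify.
Import Order.TTheory GRing.Theory Num.Theory.
Import numFieldNormedType.Exports.
Local Open Scope classical_set_scope.
Local Open Scope ring_scope.

(** A zero of phi with non-zero first coordinate is an integer multiple of a
    point z = (q^3, q^2 p, p^3) of the twisted cubic with q, p coprime, and a
    minimal point is primitive.  So if phi vanishes at the minimal point
    x_(i+1), then x_(i+1) = z up to sign, and its norm X satisfies
    |q|^3 <= X <= (1 + |xi|)^3 |q|^3.

    Such a point leaves no room for the preceding minimal point y = x_i.  Let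
    l = L(y), so that L(z) < l.  As y and z are both l-close to the line
    spanned by (1, xi, xi^3), their 2 x 2 minors are small:
      q^2 (q y_1 - p y_0)      = q^3 y_1 - y_0 q^2 p,
      q^3 y_2 - p^3 y_0
    are both O(|q|^3 l).  The first shows that the integer q y_1 - p y_0 is
    O(|q| l).  If it vanishes, then y_0 = k q and the second minor is q times
    the integer q^2 y_2 - p^3 k, which is thus O(|q|^2 l).  Hence both
    integers vanish as soon as |q|^2 l is small enough, and coprimality then
    makes y a non-zero integer multiple of z.  This is impossible since the
    norm of y is less than that of z ([collinear_cubic_point],
    [minimal_phi_neq0]).

    The exponent 2/3 is what makes |q|^2 l small: no non-zero integer point of
    norm less than X has L smaller than l, so the approximation property gives
    l = O(X^(-lambda)), whence |q|^2 l = O(X^(2/3 - lambda)), which tends to 0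
    because the integers X tend to infinity.  To avoid cube roots, this is
    used in the form l^3 X^2 -> 0 ([powR_decay]). *)

(** * Norm and L of integer points *)

Lemma real_pointE (R : realType) (x : 'rV[int]_3) j :
  real_point R x 0 j = (x 0 j)%:~R.
Proof. by rewrite mxE. Qed.

Lemma real_pointZ (R : realType) (n : int) (x : 'rV[int]_3) :
  real_point R (n *: x) = n%:~R *: real_point R x.
Proof. by rewrite /real_point map_mxZ. Qed.

Lemma norm_real_pointZ (R : realType) (n : int) (x : 'rV[int]_3) :
  `|real_point R (n *: x)| = `|n%:~R| * `|real_point R x|.
Proof. by rewrite real_pointZ mx_normZ. Qed.

Lemma le_norm_rV (R : realType) (v : 'rV[R]_3) (r : R) :
  (`|v| <= r) <-> (forall j, `|v 0 j| <= r).
Proof.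
have -> : `|v| = \big[Num.max/0]_ij `|v ij.1 ij.2| by exact: mx_normrE.
split=> [/bigmax_leP[_ h] j|h]; first exact: (h (0, j)).
apply/bigmax_leP; split=> [|[i j] _] /=; first exact: le_trans (h 0).
by rewrite (ord1 i).
Qed.

Lemma norm_entry_le (R : realType) (x : 'rV[int]_3) j :
  `|(x 0 j)%:~R| <= `|real_point R x|.
Proof. by rewrite -real_pointE; move: j; apply/le_norm_rV. Qed.

(** This is what forces the norms of minimal points to tend to infinity. *)
Lemma norm_real_point_nat (R : realType) (x : 'rV[int]_3) :
  exists n : nat, `|real_point R x| = n%:R.
Proof.
have [->|/mx_norm_neq0[[i j] /= h]] := eqVneq (`|real_point R x|) 0.
  by exists 0%N.
rewrite (ord1 i) in h; exists `|x 0%R j|%N.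
by rewrite natr_absz intr_norm -real_pointE; exact: h.
Qed.

Lemma L_ge0 {R : realType} (xi : R) v : 0 <= L xi v.
Proof. by rewrite /L le_max normr_ge0. Qed.

Lemma LZ (R : realType) (xi a : R) v : L xi (a *: v) = `|a| * L xi v.
Proof.
rewrite /L !mxE -!mulrA -!mulrBr !normrM.
by rewrite maxr_pMr.
Qed.

(** * Integer points on the cubic phi = 0 *)

Lemma coprime_decomposition {a} (b : int) : a != 0 ->
  exists g p q : int, [/\ a = q * g, b = p * g & coprimez q p].
Proof.
move=> a0; have [u [v uv]] := Bezoutz a b.
have g0 : gcdz a b != 0 by rewrite gcdz_eq0 (negbTE a0).
have /dvdzP[q aE] := dvdz_gcdl a b.
have /dvdzP[p bE] := dvdz_gcdr a b.
exists (gcdz a b), p, q; split=> //; apply/coprimezP; exists (u, v) => /=.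
apply: (mulIf g0); rewrite mul1r mulrDl -!mulrA -aE -bE; exact: uv.
Qed.

Definition cubic_point (q p : int) : 'rV[int]_3 :=
  \row_j [:: q ^+ 3; q ^+ 2 * p; p ^+ 3]`_j.

Lemma eq_scale_cubic_point {y : 'rV[int]_3} {m q p : int} :
  y 0 0 = m * q ^+ 3 -> y 0 1 = m * (q ^+ 2 * p) -> y 0 2 = m * p ^+ 3 ->
  y = m *: cubic_point q p.
Proof.
move=> h0 h1 h2; apply/rowP => j; rewrite !mxE.
case: j => -[|[|[|//]]] lt /=.
- by rewrite -h0; congr (y 0 _); apply: val_inj.
- by rewrite -h1; congr (y 0 _); apply: val_inj.
- by rewrite -h2; congr (y 0 _); apply: val_inj.
Qed.

(** The last equation reads q^2 | p^3 k, so q^2 | k by coprimality, and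
    m = k / q^2 is the factor. *)
Lemma multiple_of_cubic_point {y : 'rV[int]_3} {q p k : int} :
  q != 0 -> coprimez q p -> y 0 0 = k * q -> y 0 1 = k * p ->
  q ^+ 2 * y 0 2 = p ^+ 3 * k -> exists m, y = m *: cubic_point q p.
Proof.
move=> q0 cqp y0 y1 y2.
have /dvdzP[m kE] : (q ^+ 2 %| k)%Z.
  rewrite -(@Gauss_dvdzr _ (p ^+ 3)); last exact/coprimezXl/coprimezXr.
  by rewrite -y2 dvdz_mulr.
exists m; apply: eq_scale_cubic_point; rewrite ?y0 ?y1 ?kE; try ring.
have q20 : q ^+ 2 != 0 by rewrite expf_neq0.
by apply: (mulfI q20); rewrite y2 kE; ring.
Qed.

(** Take p/q = x_1/x_0 in lowest terms, x_0 = q g and x_1 = p g: then phi x = 0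
    becomes q^2 x_2 = p^3 g. *)
Lemma phi_eq0_param {x : 'rV[int]_3} : x 0 0 != 0 -> phi x = 0 ->
  exists n q p : int, [/\ q != 0, coprimez q p & x = n *: cubic_point q p].
Proof.
move=> x0 /eqP; rewrite subr_eq0 => /eqP h.
have [g [p [q [e0 e1 cqp]]]] := coprime_decomposition (x 0 1) x0.
have /andP[q0 g0] : (q != 0) && (g != 0) by rewrite -negb_or -mulf_eq0 -e0.
have [|||n xE] := @multiple_of_cubic_point x q p g q0 cqp.
- by rewrite e0 mulrC.
- by rewrite e1 mulrC.
- have g20 : g ^+ 2 != 0 by rewrite expf_neq0.
  apply: (mulfI g20); rewrite e0 e1 in h.
  by transitivity ((p * g) ^+ 3); [rewrite -h|]; ring.
- by exists n, q, p.
Qed.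

(** * Approximating points near a point of the cubic *)

Lemma int_small_eq0 (R : realType) (n : int) : `|n%:~R : R| < 1 -> n = 0.
Proof.
by rewrite -intr_norm (ltr_int R _ 1) => h; apply/eqP; rewrite -absz_eq0; lia.
Qed.

Lemma L_bounds {R : realType} {xi r : R} {v : 'rV[R]_3} :
  L xi v <= r -> `|v 0 1 - v 0 0 * xi| <= r /\ `|v 0 2 - v 0 0 * xi ^+ 3| <= r.
Proof. by rewrite ge_max => /andP. Qed.

Lemma cubic_pointE (q p : int) : [/\ cubic_point q p 0 0 = q ^+ 3,
  cubic_point q p 0 1 = q ^+ 2 * p & cubic_point q p 0 2 = p ^+ 3].
Proof. by split; rewrite mxE. Qed.

(** Both minors of y against the cubic point have the form q^3 a - y_0 b with
    |a|, |b| <= l, hence are bounded by (1 + B) |q|^3 l < |q|; the smallness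
    assumption turns the integers they contain into 0.  The order matters: the
    second minor is divisible by q only once q | y_0 is known. *)
Lemma collinear_cubic_point {R : realType} {xi l B : R} {q p : int}
    {y : 'rV[int]_3} :
  q != 0 -> coprimez q p ->
  L xi (real_point R (cubic_point q p)) <= l -> L xi (real_point R y) <= l ->
  `|real_point R y| <= B * `|q%:~R| ^+ 3 -> (1 + B) * (`|q%:~R| ^+ 2 * l) < 1 ->
  exists m, y = m *: cubic_point q p.
Proof.
move=> q0 cqp /L_bounds[z1 z2] /L_bounds[y1 y2] yB small.
have [e0 e1 e2] := cubic_pointE q p.
move: z1 z2 y1 y2; rewrite !real_pointE e0 e1 e2 => z1 z2 y1 y2.
have yB0 := le_trans (norm_entry_le R y 0) yB.
set Q : R := q%:~R in z1 z2 yB0 small.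
have Q0 : 0 < `|Q| by rewrite normr_gt0 intr_eq0.
have Q1 : 1 <= `|Q| by rewrite /Q -intr_norm ler1z; lia.
have est a b : `|a| <= l -> `|b| <= l ->
    `|Q ^+ 3 * a - (y 0 0)%:~R * b| < `|Q|.
  move=> al bl; apply: le_lt_trans (ler_normB _ _) _.
  rewrite [`|Q ^+ 3 * a|]normrM [`|_ * b|]normrM normrX.
  have := ler_wpM2l (exprn_ge0 3 (ltW Q0)) al.
  have := ler_pM (normr_ge0 _) (normr_ge0 _) yB0 bl.
  have : `|Q| * ((1 + B) * (`|Q| ^+ 2 * l)) < `|Q| * 1 by rewrite ltr_pM2l.
  nra.
have eq1 : q * y 0 1 = p * y 0 0.
  apply/eqP; rewrite -subr_eq0; apply/eqP/(int_small_eq0 R).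
  have := est _ _ y1 z1.
  rewrite (_ : _ - _ = Q ^+ 2 * (q * y 0 1 - p * y 0 0)%:~R); last first.
    by rewrite !(intrM, rmorphB, rmorphXn) /= -/Q; ring.
  rewrite normrM normrX => h; rewrite -(ltr_pM2l Q0) mulr1.
  apply: le_lt_trans h; rewrite expr2 -mulrA ler_peMl// mulr_ge0//.
have /dvdzP[k kE] : (q %| y 0%R 0%R)%Z.
  by rewrite -(Gauss_dvdzr _ cqp) -eq1 dvdz_mulr.
apply: (multiple_of_cubic_point q0 cqp kE).
  by apply: (mulfI q0); rewrite eq1 kE; ring.
apply/eqP; rewrite -subr_eq0; apply/eqP/(int_small_eq0 R).
have := est _ _ y2 z2.
rewrite (_ : _ - _ = Q * (q ^+ 2 * y 0 2 - p ^+ 3 * k)%:~R); last first.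
  by rewrite kE !(intrM, rmorphB, rmorphXn) /= -/Q; ring.
by rewrite normrM gtr_pMr.
Qed.

Lemma norm_cubic_point_ge (R : realType) (q p : int) :
  `|q%:~R| ^+ 3 <= `|real_point R (cubic_point q p)|.
Proof.
have [e0 _ _] := cubic_pointE q p.
by rewrite -normrX -rmorphXn -e0; exact: norm_entry_le.
Qed.

(** If L <= 1 then |p - q xi| <= 1, so |p| <= (1 + |xi|) |q|. *)
Lemma norm_cubic_point_le {R : realType} {xi : R} {q p : int} : q != 0 ->
  L xi (real_point R (cubic_point q p)) <= 1 ->
  `|real_point R (cubic_point q p)| <= (1 + `|xi|) ^+ 3 * `|q%:~R| ^+ 3.
Proof.
move=> q0 /L_bounds[+ _]; have [e0 e1 e2] := cubic_pointE q p.
rewrite !real_pointE e0 e1 => z1.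
have Q1 : 1 <= `|q%:~R : R| by rewrite -intr_norm ler1z; lia.
set Q : R := q%:~R in Q1 *.
have x0 := normr_ge0 xi.
have pB : `|p%:~R| <= (1 + `|xi|) * `|Q|.
  have h : `|p%:~R - Q * xi| <= 1.
    move: z1; rewrite (_ : _ - _ = Q ^+ 2 * (p%:~R - Q * xi)); last first.
      by rewrite !(rmorphXn, rmorphM) /= -/Q; ring.
    rewrite normrM normrX; apply: le_trans.
    by rewrite ler_peMl// exprn_ege1.
  rewrite -[p%:~R](subrK (Q * xi)); apply: le_trans (ler_normD _ _) _.
  rewrite normrM; nra.
have qB : `|Q| <= (1 + `|xi|) * `|Q| by nra.
rewrite -exprMn.
apply/le_norm_rV => j; rewrite real_pointE mxE.
case: j => -[|[|[|//]]] lt /=; rewrite !(rmorphXn, rmorphM) /= -/Q.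
- by rewrite normrX lerXn2r// nnegrE (le_trans _ qB).
- rewrite normrM normrX [leRHS]exprSr ler_pM//  ?exprn_ge0//.
  by rewrite lerXn2r// nnegrE (le_trans _ qB).
- by rewrite normrX lerXn2r// nnegrE (le_trans _ qB).
Qed.

(** * Minimal points *)

Lemma minimal_L_gt0 {R : realType} {xi : R} {x : nat -> 'rV[int]_3}
    (hx : minimal_points xi x) i :
  (1 <= i)%N -> 0 < L xi (real_point R (x i)).
Proof.
by move=> i1; apply: le_lt_trans (minimal_points_L hx i1); exact: L_ge0.
Qed.

Lemma minimal_L_lt_half {R : realType} {xi : R} {x : nat -> 'rV[int]_3}
    (hx : minimal_points xi x) i :
  (1 <= i)%N -> L xi (real_point R (x i)) < 1 / 2.
Proof.
case: i => // i _; elim: i => [|i IH]; first exact: minimal_points_L_half hx.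
by apply: lt_trans IH; apply: (minimal_points_L hx).
Qed.

(** If |n| >= 2, then z is smaller than x_i and strictly closer to the line,
    against minimality; strictness uses L(x_i) > 0. *)
Lemma minimal_primitive {R : realType} {xi : R} {x : nat -> 'rV[int]_3}
    (hx : minimal_points xi x)
    {i n z} : (1 <= i)%N -> x i = n *: z -> `|n| = 1.
Proof.
move=> i1 xE; have := minimal_points_neq0 hx i1.
rewrite xE => nz0.
have n0 : n != 0 by apply: contraNneq nz0 => ->; rewrite scale0r.
have z0 : z != 0 by apply: contraNneq nz0 => ->; rewrite scaler0.
apply/eqP/negPn/negP => n1.
have n2 : 2 <= `|n%:~R : R| by rewrite -intr_norm (ler_int R 2); lia.
have Lx := minimal_L_gt0 hx i i1; have := minimal_points_norm hx i1.
have /(minimal_points_min hx i1 z0) :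
    L xi (real_point R z) < L xi (real_point R (x i)).
  move: Lx; rewrite xE real_pointZ LZ.
  by have := L_ge0 xi (real_point R z); nra.
rewrite {1}xE norm_real_pointZ; have := normr_ge0 (real_point R z); nra.
Qed.

Lemma minimal_norm_ge {R : realType} {xi : R} {x : nat -> 'rV[int]_3}
    (hx : minimal_points xi x) i :
  (i%:R : R) <= `|real_point R (x i.+1)|.
Proof.
elim: i => [|i]; first exact: normr_ge0.
have := minimal_points_norm hx (ltn0Sn i).
have [a ->] := norm_real_point_nat R (x i.+1).
have [b ->] := norm_real_point_nat R (x i.+2).
by rewrite !ler_nat ltr_nat => ab ia; exact: leq_ltn_trans ia ab.
Qed.

(** If x_0 = 0, then x_1 = 0 as well and L is the non-zero integer |x_2|, which
    is not less than 1/2. *)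
Lemma minimal_x0_neq0 {R : realType} {xi : R} {x : nat -> 'rV[int]_3}
    (hx : minimal_points xi x) {i} :
  (1 <= i)%N -> phi (x i) = 0 -> x i 0 0 != 0.
Proof.
move=> i1 h; apply/eqP => x00.
have x01 : x i 0 1 = 0.
  apply/eqP; move: h => /eqP.
  by rewrite /phi x00 expr0n mul0r sub0r oppr_eq0 expf_eq0.
have /L_bounds[_] := ltW (minimal_L_lt_half hx i i1).
rewrite !real_pointE x00 mul0r subr0 => h2.
have x02 : x i 0 2 = 0 by apply: (int_small_eq0 R); lra.
move/eqP: (minimal_points_neq0 hx i1); apply.
by rewrite (@eq_scale_cubic_point (x i) 0 0 0) ?scale0r ?mul0r.
Qed.

(** Effective form of the theorem: d bounds |q|^2 L(x_i) when x_(i+1) is, up to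
    sign, the cubic point of q and p, because |q|^3 is at most its norm. *)
Lemma minimal_phi_neq0 {R : realType} {xi : R} {x : nat -> 'rV[int]_3}
    (hx : minimal_points xi x)
    {d : R} {i} : (1 <= i)%N ->
  (1 + (1 + `|xi|) ^+ 3) * d < 1 -> 0 <= d ->
  L xi (real_point R (x i)) ^+ 3 * `|real_point R (x i.+1)| ^+ 2 <= d ^+ 3 ->
  phi (x i.+1) != 0.
Proof.
move=> i1 dlt d0 hd; apply/eqP => phi0.
have [n [q [p [q0 cqp xE]]]] :=
  phi_eq0_param (minimal_x0_neq0 hx (ltn0Sn i) phi0) phi0.
have n1 : `|n%:~R : R| = 1.
  by rewrite -intr_norm (minimal_primitive hx (ltn0Sn i) xE).
have Nx : `|real_point R (x i.+1)| = `|real_point R (cubic_point q p)|.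
  by rewrite xE norm_real_pointZ n1 mul1r.
have Lx : L xi (real_point R (x i.+1)) = L xi (real_point R (cubic_point q p)).
  by rewrite xE real_pointZ LZ n1 mul1r.
have lt1 := minimal_points_norm hx i1.
have Lz : L xi (real_point R (cubic_point q p)) <= 1.
  by rewrite -Lx; have := minimal_L_lt_half hx i.+1 isT; lra.
have [|||m yE] := @collinear_cubic_point _ xi
    (L xi (real_point R (x i))) ((1 + `|xi|) ^+ 3) _ _ _ q0 cqp _ (lexx _).
- by rewrite -Lx ltW// minimal_points_L.
- apply: le_trans (norm_cubic_point_le q0 Lz).
  by rewrite -Nx ltW.
- apply: le_lt_trans dlt; rewrite ler_wpM2l ?addr_ge0 ?exprn_ge0 ?addr_ge0//.
  rewrite -(@ler_pXn2r _ 3)// ?nnegrE ?mulr_ge0 ?exprn_ge0 ?L_ge0//.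
  apply: le_trans hd; rewrite exprMn mulrC ler_wpM2l ?exprn_ge0 ?L_ge0//.
  rewrite -exprM mulnC exprM lerXn2r ?nnegrE ?exprn_ge0//.
  by rewrite Nx norm_cubic_point_ge.
have m0 : m != 0.
  by apply: contraNneq (minimal_points_neq0 hx i1) => m0; rewrite yE m0 scale0r.
have : 1 <= `|m%:~R : R| by rewrite -intr_norm ler1z; lia.
move: lt1; rewrite Nx yE norm_real_pointZ.
have := normr_ge0 (real_point R (cubic_point q p)); nra.
Qed.

(** The point y is not better than x_i, since it is smaller than x_(i+1). *)
Lemma minimal_L_le {R : realType} {xi : R} {x : nat -> 'rV[int]_3}
    (hx : minimal_points xi x)
    {X b : R} {i} : (1 <= i)%N -> X < `|real_point R (x i.+1)| ->
  (exists y : 'rV[int]_3, [/\ y != 0, `|real_point R y| <= X &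
     L xi (real_point R y) <= b]) -> L xi (real_point R (x i)) <= b.
Proof.
move=> i1 Xlt [y [y0 yX yb]]; apply: le_trans yb; rewrite leNgt; apply/negP.
by move=> /(minimal_points_min hx i1 y0); rewrite leNgt (le_lt_trans yX).
Qed.

(** The left-hand side is 4 c^3 X^(2 - 3 lambda).  The factor 2 is there since
    the approximation property is applied at half the norm of a minimal point,
    which makes the point it provides strictly smaller. *)
Lemma powR_decay {R : realType} {lambda c e : R} : 2 / 3 < lambda -> 0 < c ->
  0 < e -> \forall X \near +oo, (c * X `^ (- lambda)) ^+ 3 * (2 * X) ^+ 2 <= e.
Proof.
move=> hl c0 e0.
pose a := 3 * lambda - 2; have a0 : 0 < a by rewrite /a; lra.
pose B := 4 * c ^+ 3 / e.
have B0 : 0 <= B by rewrite divr_ge0 ?mulr_ge0 ?exprn_ge0 ?ltW.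
near=> X.
have X0 : 0 < X by near: X; exact: nbhs_pinfty_gt.
have XB : B `^ a^-1 <= X by near: X; exact: nbhs_pinfty_ge.
have BXa : B <= X `^ a.
  rewrite -[B]powRr1// -(mulVf (lt0r_neq0 a0)) powRrM.
  by rewrite ge0_ler_powR ?nnegrE ?powR_ge0 ?ltW.
have -> : (c * X `^ (- lambda)) ^+ 3 * (2 * X) ^+ 2 = 4 * c ^+ 3 / X `^ a.
  have -> : X `^ a = X `^ (3 * lambda) / X ^+ 2.
    by rewrite -powR_mulrn ?ltW// -powRN -powRD// gt_eqF ?implybT.
  have Xl : X `^ (3 * lambda) = (X `^ lambda) ^+ 3.
    by rewrite -powR_mulrn ?powR_ge0// -powRrM mulrC.
  rewrite Xl powRN; field.
  by rewrite !gt_eqF ?powR_gt0.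
by rewrite ler_pdivrMr ?powR_gt0// [leRHS]mulrC -ler_pdivrMr.
Unshelve. all: by end_near.
Qed.

Theorem theorem2p10 (R : realType) (xi lambda c : R) (x : nat -> 'rV[int]_3)
    (hxi : lin_indep_rat [:: 1; xi; xi ^+ 3])
    (lambda_gt0 : 0 < lambda) (c_gt0 : 0 < c)
    (happrox : \forall X \near +oo, exists y : 'rV[int]_3,
       [/\ y != 0, `|real_point R y| <= X &
           L xi (real_point R y) <= c * X `^ (- lambda)])
    (hx : minimal_points xi x)
    (hlambda : 2 / 3 < lambda) :
  \forall i \near \oo, phi (x i) != 0.
Proof.
pose K := 1 + (1 + `|xi|) ^+ 3.
have K0 : 0 < K by rewrite ltr_pwDl// exprn_ge0// addr_ge0.
(* Any positive d with K * d < 1 would do. *)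
pose d := (2 * K)^-1.
have d0 : 0 < d by rewrite invr_gt0 mulr_gt0.
have Kd : K * d < 1 by rewrite /d invfM mulrCA divff ?gt_eqF//; lra.
have [M [_ hM]] := filterI happrox (powR_decay hlambda c_gt0 (exprn_gt0 3 d0)).
have [N NM] : exists N : nat, 2 * M < N%:R.
  by exists (Num.truncn (2 * M)).+1; rewrite truncnS_gt.
(* The norm of x i.+2 is at least i.+1 >= N > 2 * M, so that its half exceeds
   the threshold M of both eventual properties. *)
exists N.+2 => // -[//|[//|i]] /=; rewrite !ltnS => Ni.
apply: (minimal_phi_neq0 hx) (ltW d0) _ => //.
set Y := `|_|.
have YN : N%:R <= Y.
  by apply: le_trans (minimal_norm_ge hx _); rewrite ler_nat ltnW.
have [|h1 h2] := hM (Y / 2).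
  by lra.
have Y0 : 0 < Y.
  apply: le_lt_trans (minimal_points_norm hx (ltn0Sn i)); exact: normr_ge0.
have hL : L xi (real_point R (x i.+1)) <= c * (Y / 2) `^ (- lambda).
  by apply: (minimal_L_le hx (X := Y / 2)) => //; rewrite -/Y; lra.
apply: le_trans h2; have -> : 2 * (Y / 2) = Y by field.
apply: ler_wpM2r; first by rewrite exprn_ge0 ?ltW.
by apply: lerXn2r; rewrite ?nnegrE ?L_ge0// mulr_ge0 ?powR_ge0 ?ltW.
Qed.
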